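(* For every $n$ with $2\le n<\omega$ there exists an algebra in $SA_n$ whose Boolean reduct is atomic and complete and which is not completely representable. Furthermore, dropping the condition of completeness, the algebra can be chosen atomic and countable: for every $n$ with $2\le n<\omega$ there is a countable atomic algebra in $SA_n$ that is not completely representable.
   Context: For distinct $i,j<n$, $[i,j]$ is the transposition of $n=\{0,\dots,n-1\}$ swapping $i$ and $j$, and $[i|j]$ is the map $n\to n$ sending $i$ to $j$ and fixing everything else. For a set $U$, a set $V\subseteq{}^nU$ is locally square if $s\circ[i|j],\,s\circ[i,j]\in V$ for all $s\in V$ and $i\ne j\in n$; then $\wp(V)=\langle\mathcal P(V);\cap,\sim,S^i_j,S_{ij}\rangle_{i\neq j\in n}$ with $\sim$ complement in $V$, $S^i_j(X)=\{q\in V:q\circ[i|j]\in X\}$, $S_{ij}(X)=\{q\in V:q\circ[i,j]\in X\}$. Abstract algebras have the type $\{\cdot,-,s^i_j,s_{ij}\}_{i\neq j\in n}$. $SA_n=\mathbf{Mod}(\Sigma_n)$, where $\Sigma_n$ is the following finite set of equations: (a) the Boolean algebra axioms; (b) each $s_{ij}$ and each $s^i_j$ is a Boolean endomorphism; (c) for a fixed finite presentation of the monoid ${}^nn$ (all maps $n\to n$ under composition) in the generators $[i,j],[i|j]$, all equations $s_{g_1}\cdots s_{g_m}x=s_{h_1}\cdots s_{h_k}x$ for the defining relations $g_1\circ\cdots\circ g_m=h_1\circ\cdots\circ h_k$, where $s_{[i,j]}=s_{ij}$ and $s_{[i|j]}=s^i_j$. (The class does not depend on the choice of presentation.) A representation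 of $\mathfrak A$ is an injective homomorphism $f:\mathfrak A\to\wp(V)$ with $V$ locally square; it is complete if $f(\prod X)=\bigcap_{x\in X}f(x)$ for every $X\subseteq\mathfrak A$ whose meet $\prod X$ exists in $\mathfrak A$. $\mathfrak A$ is completely representable if it has a complete representation. *)

(* Defs.v *)
From HB Require Import structures.
From Stdlib Require List.
From mathcomp Require Import all_boot all_order all_fingroup.
From mathcomp Require Import boolp classical_sets functions cardinality.

Set Implicit Arguments.
Unset Strict Implicit.
Unset Printing Implicit Defensive.

Local Open Scope classical_set_scope.

Definition replacement n (i j : 'I_n) : 'I_n -> 'I_n :=
  fun k => if k == i then j else k.

(* The generators [i,j] and [i|j] (i != j) of the monoid of all maps n -> n;
   they also index the non-Boolean operations s_ij and s^i_j. *)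
Variant gen n :=
  | Transp (i j : 'I_n) of i != j
  | Repl (i j : 'I_n) of i != j.

Definition gen_map n (g : gen n) : 'I_n -> 'I_n :=
  match g with
  | Transp i j _ => tperm i j
  | Repl i j _ => replacement i j
  end.

Definition word n := seq (gen n).

(* g_1 ... g_m |-> g_1 o ... o g_m, where (f o g) k = f (g k). *)
Definition word_map n (w : word n) : 'I_n -> 'I_n :=
  foldr (fun g h => gen_map g \o h) id w.

Definition relations n := seq (word n * word n).

Inductive word_cong n (R : relations n) : word n -> word n -> Prop :=
  | WC_rel a b u v : List.In (u, v) R ->
      word_cong R (a ++ u ++ b) (a ++ v ++ b)
  | WC_refl u : word_cong R u u
  | WC_sym u v : word_cong R u v -> word_cong R v u
  | WC_trans u v w : word_cong R u v -> word_cong R v w -> word_cong R u w.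

(* The finite list R of relations, on the generators [gen n], presents the
   monoid of all maps n -> n. *)
Definition presentation n (R : relations n) : Prop :=
  (forall t : 'I_n -> 'I_n, exists w, word_map w =1 t) /\
  (forall u v, word_cong R u v <-> word_map u =1 word_map v).

(* The Boolean reduct is a library Boolean algebra (possibly degenerate), with
   x . y and - x written x `&` y and ~` x in order_scope; [choiceType] is no
   restriction on the carrier, classically. *)
Record subst_alg n := SubstAlg {
  alg_disp : Order.disp_t;
  alg_sort :> ctbDistrLatticeType alg_disp;
  sop : gen n -> alg_sort -> alg_sort
}.

Definition bool_endo d (B : ctbDistrLatticeType d) (h : B -> B) : Prop :=
  (forall x y, h (x `&` y)%O = (h x `&` h y)%O) /\
  (forall x, h (~` x)%O = (~` (h x))%O).

Definition sop_word n (A : subst_alg n) (w : word n) (x : A) : A :=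
  foldr (@sop n A) x w.

(* The class SA_n, for the finite presentation R of the monoid of maps n -> n. *)
Definition in_SA n (R : relations n) (A : subst_alg n) : Prop :=
  (forall g, bool_endo (@sop n A g)) /\
  (forall u v, List.In (u, v) R -> forall x : A, sop_word u x = sop_word v x).

Definition locally_square n U (V : set ('I_n -> U)) : Prop :=
  forall s (i j : 'I_n), V s -> i != j ->
    V (s \o replacement i j) /\ V (s \o tperm i j).

Lemma locally_square_gen n U (V : set ('I_n -> U)) :
  locally_square V -> forall (q : V) g, \val q \o gen_map g \in V.
Proof.
move=> Vsq [q qV] [] i j ij; apply/mem_set => /=;
by have [] := Vsq q i j (set_mem qV) ij.
Qed.

Definition gen_act n U (V : set ('I_n -> U)) (Vsq : locally_square V)
    (g : gen n) (q : V) : V :=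
  exist _ (\val q \o gen_map g) (locally_square_gen Vsq q g).

(* The carrier is the power set of V, viewed as a type, so that complements and
   empty intersections are taken relative to V. *)
Definition wp n U (V : set ('I_n -> U)) (Vsq : locally_square V) :
    subst_alg n :=
  @SubstAlg n _ (set V : ctbDistrLatticeType _)
    (fun g X => [set q : V | X (gen_act Vsq g q)]).

Definition homomorphism n (A B : subst_alg n) (f : A -> B) : Prop :=
  [/\ forall x y : A, f (x `&` y)%O = (f x `&` f y)%O,
      forall x : A, f (~` x)%O = (~` (f x))%O
    & forall g (x : A), f (sop g x) = sop g (f x)].

Definition representation n (A : subst_alg n) U (V : set ('I_n -> U))
    (Vsq : locally_square V) (f : A -> wp Vsq) : Prop :=
  homomorphism f /\ injective f.

(* [infimums X a] says that a is the meet of X; X may be empty. *)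
Definition complete_representation n (A : subst_alg n) U
    (V : set ('I_n -> U)) (Vsq : locally_square V) (f : A -> wp Vsq) : Prop :=
  representation f /\
  forall (X : set A) (a : A), infimums X a ->
    f a = \bigcap_(x in X) (f x : set V).

Definition completely_representable n (A : subst_alg n) : Prop :=
  exists (U : Type) (V : set ('I_n -> U)) (Vsq : locally_square V)
    (f : A -> wp Vsq), complete_representation f.

Definition atom d (B : ctbDistrLatticeType d) (a : B) : Prop :=
  a <> \bot%O /\ forall x : B, (x <= a)%O -> x = \bot%O \/ x = a.

Definition atomic d (B : ctbDistrLatticeType d) : Prop :=
  forall x : B, x <> \bot%O -> exists2 a, atom a & (a <= x)%O.

Definition complete_ba d (B : ctbDistrLatticeType d) : Prop :=
  forall X : set B, supremums X !=set0 /\ infimums X !=set0.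

Lemma word_cong_sop n (R : relations n) (A : subst_alg n) u v :
  in_SA R A -> word_cong R u v -> forall x : A, sop_word u x = sop_word v x.
Proof.
move=> [_ AR]; elim=> {u v} [a b u v Ruv x|//|u v _ IH x|u v w _ IH1 _ IH2 x].
- by rewrite /sop_word !foldr_cat; congr foldr; exact: AR.
- by rewrite IH.
- by rewrite IH1.
Qed.

Lemma in_SA_indep n (R R' : relations n) (A : subst_alg n) :
  presentation R -> presentation R' -> in_SA R A -> in_SA R' A.
Proof.
move=> [_ PR] [_ PR'] AR; split=> [|u v R'uv]; first by case: AR.
apply: (word_cong_sop AR); apply/PR/PR'.
by rewrite -[u]cats0 -[v]cats0 -[u ++ _]cat0s -[v ++ _]cat0s; constructor.
Qed.

Lemma word_map_cat n (u v : word n) :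
  word_map (u ++ v) =1 word_map u \o word_map v.
Proof. by elim: u => //= g u IH k; rewrite /= IH. Qed.

Lemma word_map_perm n (s : {perm 'I_n}) : exists w, word_map w =1 s.
Proof.
have [ts -> _] := prod_tpermP s; elim: ts => [|[i j] ts [w wE]].
  by exists [::] => k; rewrite big_nil perm1.
have [ij|ij] := eqVneq i j.
  by exists w => k; rewrite wE big_cons /= ij tperm1 mul1g.
by exists (w ++ [:: Transp ij]) => k; rewrite word_map_cat big_cons permM /= wE.
Qed.

Lemma word_map_surj n (t : 'I_n -> 'I_n) : exists w, word_map w =1 t.
Proof.
have [m] := ubnP #|[pred c | c \notin codom t]|; elim: m t => // m IH t tm.
have [/injectiveP tinj|/injectivePn[a [b ab tab]]] := boolP (injectiveb t).
  by have [w wE] := word_map_perm (perm tinj); exists w => k; rewrite wE permE.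
have [c cNt] : exists c, c \notin codom t.
  apply/existsP; rewrite -negb_forall; apply/negP => /forallP tsurj.
  have := leq_image_card t [pred k | k != a]; rewrite leqNgt => /negP; apply.
  rewrite -[ltnRHS](_ : #|'I_n| = _).
    rewrite [ltnRHS](cardD1 a) inE add1n ltnS; apply/eq_leq/eq_card => k.
    by rewrite !inE andbT.
  apply/esym/eq_card => k; rewrite [RHS]inE; apply/fintype.imageP.
  have /codomP[l ->] := tsurj k; have [->|la] := eqVneq l a; last by exists l.
  by exists b => //; rewrite inE eq_sym.
have cta : c != t a by apply: contraNneq cNt => ->; exact: codom_f.
pose t' k := if k == a then c else t k.
have [|w wE] := IH t'.
  apply: leq_trans (_ : _ <= #|[pred k | k \notin codom t]|)%N _ => //.
  apply: proper_card; apply/properP; split.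
    apply/fintype.subsetP => k; rewrite !inE; apply: contra => /codomP[l ->].
    have [->|la] := eqVneq l a; last first.
      by apply/codomP; exists l; rewrite /t' (negPf la).
    by apply/codomP; exists b; rewrite /t' eq_sym (negPf ab).
  exists c; rewrite !inE ?cNt // negbK; apply/codomP; exists a.
  by rewrite /t' eqxx.
exists (Repl cta :: w) => k; rewrite /= wE /replacement /t'.
have [->|ka] := eqVneq k a; first by rewrite eqxx.
by case: eqP => // tkc; move: cNt; rewrite -tkc codom_f.
Qed.

Lemma gens_finite n : exists G : seq (gen n), forall g, List.In g G.
Proof.
have InE (T : eqType) (S : Type) (h : T -> S) s x :
    x \in s -> List.In (h x) [seq h y | y <- s].
  by elim: s => //= y s IH; rewrite inE => /predU1P[->|/IH]; [left|right].
pose D := {p : 'I_n * 'I_n | p.1 != p.2}.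
exists ([seq Transp (valP p) | p <- enum {: D}]
  ++ [seq Repl (valP p) | p <- enum {: D}]) => -[] i j ij; apply/List.in_or_app.
all: have pD : (exist _ (i, j) ij : D) \in enum {: D} by rewrite mem_enum.
- left; have := InE _ _ (fun p : D => Transp (valP p)) _ _ pD.
  by rewrite (bool_irrelevance (valP (exist _ (i, j) ij : D)) ij).
- right; have := InE _ _ (fun p : D => Repl (valP p)) _ _ pD.
  by rewrite (bool_irrelevance (valP (exist _ (i, j) ij : D)) ij).
Qed.

Lemma presentation_exists n : exists R : relations n, presentation R.
Proof.
have [W WE] := @choice {ffun 'I_n -> 'I_n} _ _ (fun t => word_map_surj t).
have [G GP] := gens_finite n.
pose rel (g : gen n) (t : {ffun 'I_n -> 'I_n}) :=
  (g :: W t, W [ffun k => gen_map g (t k)]).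
pose R := (W [ffun k => k], [::]) ::
  List.flat_map (fun g => List.map (rel g) (enum {ffun 'I_n -> 'I_n})) G.
have relR g t : List.In (rel g t) R.
  right; apply/List.in_flat_map; exists g; split=> //; apply/List.in_map.
  have : t \in enum {ffun 'I_n -> 'I_n} by rewrite mem_enum.
  by elim: (enum _) => //= y s IH; rewrite inE => /predU1P[->|/IH]; [left|right].
have sound u v : List.In (u, v) R -> word_map u =1 word_map v.
  case=> [[<- <-] k|]; first by rewrite WE ffunE.
  by move=> /List.in_flat_map[g [_ /List.in_map_iff[t [[<- <-] _]]]] k;
    rewrite /= !WE ffunE.
have WC_cons g u v : word_cong R u v -> word_cong R (g :: u) (g :: v).
  elim=> {u v} [a b u v Ruv|u|u v _ IH|u v w _ IH1 _ IH2].
  - by rewrite -!cat_cons; exact: WC_rel.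
  - exact: WC_refl.
  - exact: WC_sym.
  - exact: WC_trans IH1 IH2.
have WC1 u v : List.In (u, v) R -> word_cong R u v.
  rewrite -[X in word_cong R X]cats0 -[X in word_cong R _ X]cats0.
  exact: (@WC_rel _ _ [::] [::]).
have norm u : word_cong R u (W [ffun k => word_map u k]).
  elim: u => [|g u IH]; first by apply/WC_sym/WC1; left.
  apply: WC_trans (WC_cons g _ _ IH) _; apply: WC1.
  have := relR g [ffun k => word_map u k]; rewrite /rel.
  by congr (List.In (_, W _) R); apply/ffunP => k; rewrite !ffunE.
exists R; split=> [|u v]; first exact: word_map_surj.
split=> [|uv].
  elim=> {u v} [a b u v /sound uv k|//|u v _ IH k|u v w _ IH1 _ IH2 k].
  - by rewrite !word_map_cat /= !word_map_cat /= uv.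
  - by rewrite IH.
  - by rewrite IH1.
apply: WC_trans (norm u) _; apply: WC_sym.
have -> : [ffun k => word_map u k] = [ffun k => word_map v k].
  by apply/ffunP => k; rewrite !ffunE.
exact: norm.
Qed.

(* Main.v *)
(** An algebra with a complete representation [f] whose Boolean reduct is atomic
    has its points covered by the images of its atoms, since the coatoms meet to
    0.  Applying this to the point [q o [0|1]] shows that some atom [b] has
    [s^0_1 b <> 0].  So it suffices to find an atomic Boolean algebra with an
    ultrafilter containing no atom: let [s_g] be the identity when [g] is a
    permutation, and otherwise send the members of the ultrafilter to 1 and the
    other elements to 0.  A composition of maps is a permutation iff all its
    factors are, so this satisfies the equations of SA_n, and [s^0_1] kills
    every atom.  The power set of nat and its algebra of finite and cofinite
    sets, with a nonprincipal ultrafilter, give the two examples. *)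
Require Import Defs.
From HB Require Import structures.
From mathcomp Require Import all_boot all_order perm.
From mathcomp Require Import boolp classical_sets functions cardinality.
From mathcomp Require Import filter.

Set Implicit Arguments.
Unset Strict Implicit.
Unset Printing Implicit Defensive.

Import Order.Theory.
Local Open Scope order_scope.

(** * Injectivity of composites of the generators *)

Definition is_transp n (g : gen n) : bool := if g is Transp _ _ _ then true else false.

(** An injective self-map of a finite set is onto, so the letters [i] and [j] of a replacement have
    preimages under the factors to its right, and the replacement merges them. *)
Lemma word_map_inj n (w : word n) : injective (word_map w) <-> all (@is_transp n) w.
Proof.
elim: w => [|g w [IH1 IH2]] /=; first by split=> // _ x y.
split=> [gw_inj|/andP[]]; last first.
  by case: g => //= i j ij _ /IH2 w_inj; exact: inj_comp perm_inj w_inj.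
have w_inj : injective (word_map w) by move=> x y xy; apply: gw_inj; rewrite /= xy.
rewrite IH1 // andbT; case: g gw_inj => //= i j ij gw_inj.
have [v _ vK] := injF_bij w_inj.
have /gw_inj/(can_inj vK)/eqP : (replacement i j \o word_map w) (v i) =
    (replacement i j \o word_map w) (v j).
  by rewrite /= !vK /replacement eqxx eq_sym (negPf ij).
by rewrite (negPf ij).
Qed.

(** * The algebra built from an ultrafilter *)

Section CollapseAlgebra.
Context (n : nat) d (B : ctbDistrLatticeType d) (h : B -> bool).
Hypothesis hI : forall x y, h (x `&` y) = h x && h y.
Hypothesis hC : forall x, h (~` x) = ~~ h x.

(** With [h] the indicator of an ultrafilter, this is the Boolean endomorphism of [B] that factors
    through the two-element algebra. *)
Definition collapse (x : B) : B := if h x then \top else \bot.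

Definition collapse_alg : subst_alg n :=
  @SubstAlg n d B (fun g x => if is_transp g then x else collapse x).

Lemma indicator_bot : h \bot = false.
Proof. by rewrite -(meetxC \bot) hI hC andbN. Qed.

Lemma indicator_top : h \top.
Proof. by rewrite -compl0 hC indicator_bot. Qed.

(** Since [h] is true at 1 and false at 0, [collapse] is idempotent: only the presence of some
    replacement in the word matters. *)
Lemma collapse_word (w : word n) (x : collapse_alg) :
  sop_word w x = if all (@is_transp n) w then x else collapse x.
Proof.
elim: w => //= g w; rewrite /sop_word /= => ->.
case: (is_transp g) => //=; case: all => //.
by rewrite /collapse; case: (h x); rewrite ?indicator_top ?indicator_bot.
Qed.

Lemma collapse_alg_in_SA (R : relations n) : presentation R -> in_SA R collapse_alg.
Proof.
move=> [_ RP]; split=> [g|u v Ruv x].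
  split=> [x y|x] /=; case: is_transp => //; rewrite /collapse ?hI ?hC.
    by case: (h x); case: (h y); rewrite /= ?meetx1 ?meetx0 ?meet0x.
  by case: (h x); rewrite /= ?compl1 ?compl0.
have /RP uv : word_cong R u v.
  by rewrite -[u]cats0 -[v]cats0 -[u ++ _]cat0s -[v ++ _]cat0s; constructor.
rewrite !collapse_word; congr (if _ then _ else _).
apply/idP/idP => /word_map_inj w_inj; apply/word_map_inj.
  exact: eq_inj uv.
by apply: (eq_inj w_inj) => k; rewrite uv.
Qed.

(** A nonzero lower bound would lie above an atom, which would then lie below its own complement. *)
Lemma infimum_coatoms : atomic B -> infimums [set ~` a | a in @atom d B] \bot.
Proof.
move=> B_atomic; split=> [x _|y y_lb]; first exact: le0x.
have [->|/eqP/B_atomic[a a_atom a_le]] := eqVneq y \bot => //.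
have : a <= ~` a by apply: le_trans a_le (y_lb _ _); exists a.
move=> /meet_idPl; rewrite meetxC => a0.
by case: a_atom; rewrite -a0.
Qed.

Lemma collapse_alg_not_completely_representable : (2 <= n)%N -> atomic B ->
  (forall a, atom a -> h a = false) -> ~ completely_representable collapse_alg.
Proof.
move=> n2 B_atomic h_atom [U [V [Vsq [f [[[fI fC fs] f_inj] f_meet]]]]].
have fbot : f \bot = classical_sets.set0.
  by rewrite -(meetxC \bot) fI fC meetxC.
(* A point outside every [f a] would lie in the image of every coatom, hence in [f \bot], which is
   empty. *)
have cover (p : V) : exists2 a, @atom d B a & f a p.
  apply: contrapT => p_out.
  have := f_meet _ _ (infimum_coatoms B_atomic); rewrite fbot => /seteqP[_ /(_ p)].
  apply=> _ [a a_atom <-] /=; rewrite fC complEset => fap.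
  by apply: p_out; exists a.
(* If [V] were empty, [f] would identify 0 and 1, which [h] separates. *)
have [q] : exists q : V, True.
  apply: contrapT => V0; have /f_inj/esym top_bot : f \bot = f \top.
    by apply/seteqP; split=> q; case: V0; exists q.
  by have := indicator_top; rewrite top_bot indicator_bot.
move=> _; pose i : 'I_n := Ordinal (leq_trans (isT : 0 < 2)%N n2).
pose j : 'I_n := Ordinal n2.
have ij : i != j by [].
have [a a_atom faq] := cover (gen_act Vsq (Repl ij) q).
(* The replacement sends [a] to 0, yet [q] lies in the image of the result because [q] composed with
   it lies in [f a]. *)
have := fs (Repl ij) a; rewrite /= /collapse h_atom // fbot.
by move=> /seteqP[_ /(_ q faq)].
Qed.

End CollapseAlgebra.

(** * Fields of sets of natural numbers containing all singletons *)

Definition embeds_with_singletons d (B : ctbDistrLatticeType d)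
    (v : B -> set nat) : Prop :=
  [/\ injective v, {morph v : x y / x `&` y}, {morph v : x / ~` x}
    & forall k, exists x, v x = [set k]%classic].

Lemma embeds_with_singletons_atom d (B : ctbDistrLatticeType d) v :
  @embeds_with_singletons d B v ->
  forall x : B, x <> \bot -> exists k a, [/\ v a = [set k]%classic, atom a & a <= x].
Proof.
move=> [v_inj vI vC v1].
have vbot : v \bot = classical_sets.set0.
  by rewrite -(meetxC \bot) vI vC meetxC.
have vle x y : (x <= y) = (v x <= v y) by rewrite !leEmeet -vI (inj_eq v_inj).
move=> x x0; have [k xk] : exists k, v x k.
  apply: contrapT => xN; apply/x0/v_inj; rewrite vbot; apply/seteqP.
  by split=> // k xk; apply: xN; exists k.
have [a ak] := v1 k; exists k, a; split=> //; last first.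
  by rewrite vle ak; apply/subsetPset => _ ->.
split=> [a0|y]; first by have : [set k]%classic k by []; rewrite -ak a0 vbot.
rewrite vle ak => /subsetPset /subset_set1[]y_eq; [left|right];
by apply: v_inj; rewrite y_eq ?vbot ?ak.
Qed.

(** Only the operations are quantified existentially: the Boolean reduct stays [B], so completeness
    or countability of [B] carries over. *)
Lemma field_of_sets_counterexample n (R : relations n) d
    (B : ctbDistrLatticeType d) (v : B -> set nat) :
  (2 <= n)%N -> presentation R -> embeds_with_singletons v ->
  exists op : gen n -> B -> B, let A := SubstAlg op in
    [/\ in_SA R A, atomic A & ~ completely_representable A].
Proof.
move=> n2 RP vB; have v_atom := embeds_with_singletons_atom vB.
have [v_inj vI vC v1] := vB.
(* Extending the filter of cofinite sets makes [G] nonprincipal; [h] is its pullback along [v]. *)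
have [G [G_ultra G_frechet]] := ultraFilterLemma frechet_properfilter_nat.
pose h (x : B) := `[<G (v x)>].
have B_atomic : atomic B.
  by move=> x /v_atom[k [a [_ a_atom ax]]]; exists a.
have hI x y : h (x `&` y) = h x && h y.
  rewrite /h vI; apply/asboolP/andP => [Gxy|[/asboolP Gx /asboolP Gy]].
    by split; apply/asboolP; apply: filterS Gxy => k [].
  exact: filterI.
have GC S : ~ (G S /\ G (~` S)).
  by case=> GS GSC; apply: (@filter_not_empty _ G); rewrite -(setICr S); exact: filterI.
have hC x : h (~` x) = ~~ h x.
  rewrite /h vC -asbool_neg; apply: asbool_equiv_eq; split=> [GxC Gx|nGx].
    by apply: (GC (v x)).
  by have [] := in_ultra_setVsetC (v x) G_ultra.
have h_atom a : atom a -> h a = false.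
  (* An atom has a singleton atom below it and so equals it; the complement of a singleton is
     cofinite, hence in [G]. *)
  move=> [a0 a_min]; have [k [b [bk [b0 _] ba]]] := v_atom a a0.
  have [//|ab] := a_min b ba; rewrite ab in bk.
  apply/asboolPn => Ga; apply: (GC (v a)); split=> //; rewrite bk.
  by apply: G_frechet; rewrite /frechet_filter /= setCK; exact: finite_set1.
exists (fun g x => if is_transp g then x else collapse h x); split=> //.
- exact: collapse_alg_in_SA.
- exact: collapse_alg_not_completely_representable.
Qed.

(** * The algebra of finite and cofinite sets *)

Definition fincof : pred (set nat) :=
  fun S => `[< finite_set S \/ finite_set (~` S)%classic >].

Lemma fincofC S : fincof S -> fincof (~` S)%classic.
Proof. by move=> /asboolP S_fin; apply/asboolP; rewrite setCK; tauto. Qed.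

Lemma fincofI : {in fincof &, forall S T, fincof (S `&` T)%classic}.
Proof.
move=> S T /asboolP[S_fin|SC_fin] /asboolP[T_fin|TC_fin]; apply/asboolP.
- by left; apply: finite_setI; left.
- by left; apply: finite_setI; left.
- by left; apply: finite_setI; right.
- by right; rewrite setCI finite_setU.
Qed.

Lemma fincofU : {in fincof &, forall S T, fincof (S `|` T)%classic}.
Proof.
move=> S T S_fc T_fc; rewrite -[X in fincof X]setCK setCU.
by apply/fincofC/fincofI; exact: fincofC.
Qed.

Lemma fincof0 : fincof classical_sets.set0.
Proof. by apply/asboolP; left. Qed.

Lemma fincofT : fincof [set: nat]%classic.
Proof. by rewrite -setC0; exact/fincofC/fincof0. Qed.

Record fincof_set := FincofSet { fincof_val :> set nat; _ : fincof fincof_val }.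

HB.instance Definition _ := [isSub for fincof_val].
HB.instance Definition _ := [Choice of fincof_set by <:].
HB.instance Definition _ :=
  Order.SubChoice_isTBSubLattice.Build _ _ _ set_display fincof_set
    fincofI fincofU fincof0 fincofT.

Lemma fincof_meetUl : @left_distributive fincof_set _ Order.meet Order.join.
Proof. by move=> x y z; apply/val_inj/setIUl. Qed.

HB.instance Definition _ :=
  Order.Lattice_Meet_isDistrLattice.Build set_display fincof_set fincof_meetUl.

Definition fincof_compl (S : fincof_set) : fincof_set := FincofSet (fincofC (valP S)).

Lemma fincof_joinxC S : S `|` fincof_compl S = \top.
Proof. by exact/val_inj/setUv. Qed.

Lemma fincof_meetxC S : S `&` fincof_compl S = \bot.
Proof. by exact/val_inj/setICr. Qed.

HB.instance Definition _ :=
  Order.TBDistrLattice_hasComplement.Build set_display fincof_set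
    fincof_joinxC fincof_meetxC.

(** There are countably many finite sets of natural numbers, and each member is coded by a finite
    set, itself or its complement, with a tag saying which. *)
Lemma fincof_set_countable : countable [set: fincof_set]%classic.
Proof.
have /countable_injP[f f_inj] := countable_finite_subset (countableP [set: nat]%classic).
have {}f_inj S T : finite_set S -> finite_set T -> f S = f T -> S = T.
  by move=> S_fin T_fin; apply: f_inj; rewrite inE.
pose code (S : fincof_set) := choice.pickle
  (if `[< finite_set S >] then (true, f S) else (false, f (~` S)%classic)).
apply/countable_injP; exists code => S T _ _.
have cofin (X : fincof_set) : ~ finite_set X -> finite_set (~` X)%classic.
  by case: (asboolP _ (valP X)).
move=> /(pcan_inj choice.pickleK); case: asboolP => S_fin; case: asboolP => T_fin // -[].
  by move=> /f_inj-/(_ S_fin T_fin); exact: val_inj.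
by move=> /f_inj-/(_ (cofin _ S_fin) (cofin _ T_fin))/setC_inj; exact: val_inj.
Qed.

Lemma complete_ba_set T : complete_ba (set T).
Proof.
move=> X; split.
  exists (\bigcup_(S in X) S)%classic; split=> [S XS|S S_ub].
    by apply/subsetPset; exact: bigcup_sup.
  by apply/subsetPset; apply: bigcup_sub => A /S_ub/subsetPset.
exists (\bigcap_(S in X) S)%classic; split=> [S XS|S S_lb].
  by apply/subsetPset; exact: bigcap_inf.
by apply/subsetPset; apply: sub_bigcap => A /S_lb/subsetPset.
Qed.

Theorem theorem3p10 (n : nat) (hn : (2 <= n)%N) (R : relations n)
    (hR : presentation R) :
  (exists A : subst_alg n,
     [/\ in_SA R A, atomic A, complete_ba A & ~ completely_representable A]) /\
  (exists A : subst_alg n,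
     [/\ in_SA R A, atomic A, countable [set: A]%classic
       & ~ completely_representable A]).
Proof.
split.
  have [|op [A_SA A_atomic A_not_CR]] :=
    @field_of_sets_counterexample n R _ (set nat) id hn hR.
    by split=> // k; exists [set k]%classic.
  by exists (SubstAlg op); split=> //; exact: complete_ba_set.
have [|op [A_SA A_atomic A_not_CR]] :=
  @field_of_sets_counterexample n R _ fincof_set fincof_val hn hR.
  split=> // [|k]; first exact: val_inj.
  have k_fc : fincof [set k]%classic by apply/asboolP; left.
  by exists (FincofSet k_fc).
by exists (SubstAlg op); split=> //; exact: fincof_set_countable.
Qed.
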